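(* Let $p$ be a prime, let $\Bbbk$ be the algebraic closure of $\mathbb{F}_p$, and let $n\in\mathbb{N}$. For all $(\pi,\tau)\in\Phi_{n}(\Bbbk^{\circ})$ the indecomposable supercharacter $\xi^{\pi,\tau}$ of $U_{n}(\Bbbk)$ is defined (that is, the limit $\xi^{\pi,\tau}(g)=\lim_{m\to\infty}\xi^{\pi,\tau_{m}}(g)$ exists for every $g\in U_n(\Bbbk)$, and the resulting function is an indecomposable supercharacter of $U_n(\Bbbk)$). Moreover, for every $(\pi,\tau)\in\Phi_{n}(\Bbbk^{\circ})$ and every $(\pi',\alpha)\in\Phi_{n}(\Bbbk)$, the constant value $\xi^{\pi,\tau}(K_{\pi',\alpha})$ of $\xi^{\pi,\tau}$ on the superclass $K_{\pi',\alpha}$ is equal to $0$ unless $\mathcal{D}(\pi)\subseteq\mathcal{R}(\pi')$ and $\mathrm{nest}_{\pi}(\pi')=0$, in which case it is given by $\xi^{\pi,\tau}(K_{\pi',\alpha})=\vartheta_{\pi,\tau}(e_{\pi',\alpha})$.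
   Context: Let $\Bbbk_m=\mathbb{F}_{p^{m!}}\subseteq\Bbbk$, so $\Bbbk=\bigcup_m\Bbbk_m$. For a field $F$, $\mathfrak{u}_n(F)$ is the algebra of strictly upper triangular $n\times n$ matrices over $F$ and $U_n(F)=1+\mathfrak{u}_n(F)$ (discrete topology). Put $\Gamma=U_n(\Bbbk)\times U_n(\Bbbk)$ and $\Gamma_m=U_n(\Bbbk_m)\times U_n(\Bbbk_m)$. These act on $\mathfrak{u}_n(\Bbbk)$, resp. $\mathfrak{u}_n(\Bbbk_m)$, by $(g,h)\cdot a=gah^{-1}$, and on the Pontryagin duals $\mathfrak{u}_n(\Bbbk)^{\circ}$, $\mathfrak{u}_n(\Bbbk_m)^{\circ}$ of the additive groups by $((g,h)\cdot\vartheta)(a)=\vartheta(g^{-1}ah)$. $\Bbbk^{\circ}$, $\Bbbk_m^{\circ}$ denote the Pontryagin duals of the (discrete) additive groups of $\Bbbk$, $\Bbbk_m$; $\mathbf{0}$ denotes the trivial character, and dual groups are written additively. A superclass of $U_n(\Bbbk)$ is a set $1+\Gamma\cdot a$, $a\in\mathfrak{u}_n(\Bbbk)$. A supercharacter is a positive definite function $\varphi\colon U_n(\Bbbk)\to\mathbb{C}$ with $\varphi(1)=1$ that is constant on superclasses; the indecomposable supercharacters are the extreme points of the convex set of supercharacters. For a set partition $\pi$ of $[n]=\{1,\dots,n\}$, an arc of $\pi$ is a pair $(i,j)$, $1\le i<j\le n$, with $i,j$ in the same block $B$ of $\pi$ and no $k\in B$ with $i<k<j$; $\mathcal{D}(\pi)$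 is the set of arcs. $\Phi_n(\Bbbk)$ is the set of pairs $(\pi,\alpha)$ with $\pi$ a set partition of $[n]$ and $\alpha\colon\mathcal{D}(\pi)\to\Bbbk\setminus\{0\}$; $\Phi_n(\Bbbk^{\circ})$ is the set of pairs $(\pi,\tau)$ with $\tau\colon\mathcal{D}(\pi)\to\Bbbk^{\circ}\setminus\{\mathbf{0}\}$; $\Phi_n(\Bbbk_m^{\circ})$ is defined likewise. With $e_{i,j}$ the elementary matrices, $e_{\pi,\alpha}=\sum_{(i,j)\in\mathcal{D}(\pi)}\alpha(i,j)e_{i,j}$ and $K_{\pi,\alpha}=1+\Gamma\cdot e_{\pi,\alpha}$ (the superclasses of $U_n(\Bbbk)$ are exactly the $K_{\pi,\alpha}$, $(\pi,\alpha)\in\Phi_n(\Bbbk)$, without repetition). For $(\pi,\tau)\in\Phi_n(\Bbbk^{\circ})$, $\vartheta_{\pi,\tau}\in\mathfrak{u}_n(\Bbbk)^{\circ}$ is the character $\vartheta_{\pi,\tau}(b)=\prod_{(i,j)\in\mathcal{D}(\pi)}\tau(i,j)(b_{i,j})$; for $(\pi,\tau)\in\Phi_n(\Bbbk_m^{\circ})$, $\vartheta_{\pi,\tau}\in\mathfrak{u}_n(\Bbbk_m)^{\circ}$ is defined by the same formula and $$\xi^{\pi,\tau}(g)=\frac{1}{|\Gamma_m\cdot\vartheta_{\pi,\tau}|}\sum_{\theta\in\Gamma_m\cdot\vartheta_{\pi,\tau}}\theta(g-1),\qquad g\in U_n(\Bbbk_m).$$ For $(\pi,\tau)\in\Phi_n(\Bbbk^{\circ})$,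 $\tau_m(i,j)$ denotes the restriction of $\tau(i,j)$ to $\Bbbk_m$; for all sufficiently large $m$ these are all nontrivial, so $(\pi,\tau_m)\in\Phi_n(\Bbbk_m^{\circ})$. For fixed $g\in U_n(\Bbbk)$, $\xi^{\pi,\tau_m}(g)$ is thus defined for all sufficiently large $m$. For a set partition $\pi$ of $[n]$: $\mathcal{S}(\pi)=\{(i,l),(k,j):(i,j)\in\mathcal{D}(\pi),\ j<l\le n,\ 1\le k<i\}$ and $\mathcal{R}(\pi)=\{(i,j):1\le i<j\le n\}\setminus\mathcal{S}(\pi)$. For set partitions $\pi,\pi'$: $\mathrm{nest}_{\pi}(\pi')=\sum_{(i,j)\in\mathcal{D}(\pi)}|\{(k,l)\in\mathcal{D}(\pi'):i<k<l<j\}|$. *)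

(* Defs.v *)
From HB Require Import structures.
From mathcomp Require Import all_boot all_order all_algebra finmap.
From mathcomp Require Import all_classical all_reals topology normedtype.
From mathcomp Require Import complex.

Set Implicit Arguments.
Unset Strict Implicit.
Unset Printing Implicit Defensive.

Import Order.TTheory GRing.Theory Num.Theory.
Import numFieldNormedType.Exports.

Local Open Scope classical_set_scope.
Local Open Scope ring_scope.

Definition strict_upper (F : fieldType) (n : nat) : {pred 'M[F]_n} :=
  [pred a : 'M[F]_n | [forall i : 'I_n, forall j : 'I_n, (j <= i)%N ==> (a i j == 0)]].
Arguments strict_upper : clear implicits.

Lemma strict_upperP (F : fieldType) (n : nat) (a : 'M[F]_n) :
  reflect (forall i j : 'I_n, (j <= i)%N -> a i j = 0) (a \in strict_upper F n).
Proof.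
apply: (iffP forallP) => [h i j ji|h i].
  by move/forallP: (h i) => /(_ j); rewrite ji => /eqP.
by apply/forallP => j; apply/implyP => ji; rewrite h.
Qed.

Fact strict_upper_zmod (F : fieldType) (n : nat) : zmod_closed (strict_upper F n).
Proof.
split=> [|a b /strict_upperP ha /strict_upperP hb]; apply/strict_upperP => i j ji.
  by rewrite mxE.
by rewrite !mxE ha // hb // subr0.
Qed.
HB.instance Definition _ (F : fieldType) (n : nat) :=
  GRing.isZmodClosed.Build 'M[F]_n (strict_upper F n) (strict_upper_zmod F n).

Fact strict_upper_mul (F : fieldType) (n : nat) (a b : 'M[F]_n) :
  a \in strict_upper F n -> b \in strict_upper F n -> a *m b \in strict_upper F n.
Proof.
move=> /strict_upperP ha /strict_upperP hb; apply/strict_upperP => i j ji.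
rewrite mxE big1 // => k _; case: (leqP k i) => ki; first by rewrite ha ?mul0r.
by rewrite hb ?mulr0 // (leq_trans ji) // ltnW.
Qed.

(* The algebra u_n(F), used through its additive group. *)
Record nilp (F : fieldType) (n : nat) :=
  Nilp { nval :> 'M[F]_n; nvalP : nval \in strict_upper F n }.
HB.instance Definition _ (F : fieldType) (n : nat) := [isSub for @nval F n].
HB.instance Definition _ (F : fieldType) (n : nat) := [Choice of nilp F n by <:].
HB.instance Definition _ (F : fieldType) (n : nat) :=
  [SubChoice_isSubZmodule of nilp F n by <:].

(* The group U_n(F) = 1 + u_n(F). *)
Record unip (F : fieldType) (n : nat) :=
  Unip { uval :> 'M[F]_n; uvalP : uval - 1%:M \in strict_upper F n }.
HB.instance Definition _ (F : fieldType) (n : nat) := [isSub for @uval F n].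
HB.instance Definition _ (F : fieldType) (n : nat) := [Choice of unip F n by <:].

Section UnipGroup.
Variables (F : fieldType) (n : nat).
Implicit Types g h : unip F n.

Lemma unipE g (i j : 'I_n) : (j <= i)%N -> g i j = (i == j)%:R.
Proof.
by move=> ji; have /strict_upperP/(_ _ _ ji)/eqP := uvalP g;
   rewrite !mxE subr_eq0 => /eqP.
Qed.

Fact unip_one_subproof : (1%:M : 'M[F]_n) - 1%:M \in strict_upper F n.
Proof. by rewrite subrr rpred0. Qed.
Definition unip_one := Unip unip_one_subproof.

Fact unip_mul_subproof g h : (g : 'M_n) *m h - 1%:M \in strict_upper F n.
Proof.
have -> : (g : 'M_n) *m h - 1%:M =
    (uval g - 1%:M) *m (uval h - 1%:M) + ((uval g - 1%:M) + (uval h - 1%:M)).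
  by rewrite [in RHS]mulmxBl mul1mx mulmxBr mulmx1 addrACA addNr addr0 addrA subrK.
by rewrite rpredD ?strict_upper_mul ?uvalP // rpredD ?uvalP.
Qed.
Definition unip_mul g h := Unip (unip_mul_subproof g h).

Lemma unip_unitmx g : (g : 'M_n) \in unitmx.
Proof.
rewrite -unitmx_tr unitmxE det_trig.
  rewrite big1 ?unitr1 // => i _; by rewrite mxE unipE ?eqxx.
apply/is_trig_mxP => i j ij; rewrite mxE unipE ?(ltnW ij) //.
by rewrite -val_eqE /= gtn_eqF.
Qed.

Fact unip_inv_subproof g : invmx (g : 'M_n) - 1%:M \in strict_upper F n.
Proof.
set h := invmx _.
have hg : h *m g = 1%:M by rewrite mulVmx ?unip_unitmx.
suff H k (i j : 'I_n) : (j < k)%N -> (j <= i)%N -> h i j = (i == j)%:R.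
  by apply/strict_upperP => i j ji; rewrite !mxE (H j.+1) // subrr.
elim: k i j => // k IH i j; rewrite ltnS => jk ji.
have := congr1 (fun M : 'M_n => M i j) hg; rewrite !mxE => <-.
rewrite (bigD1 j) //= unipE // eqxx mulr1 big1 ?addr0 // => l lj.
case: (ltnP l j) => [ltlj|lejl].
  rewrite IH ?(leq_trans ltlj) // ?(leq_trans (ltnW ltlj)) //.
  by rewrite -val_eqE /= gtn_eqF ?mul0r // (leq_trans ltlj).
by rewrite unipE // (negPf lj) mulr0.
Qed.
Definition unip_inv g := Unip (unip_inv_subproof g).

Fact unip_mulA : associative unip_mul.
Proof. by move=> x y z; apply: val_inj; rewrite /= mulmxA. Qed.
Fact unip_mul1g : left_id unip_one unip_mul.
Proof. by move=> x; apply: val_inj; rewrite /= mul1mx. Qed.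
Fact unip_mulg1 : right_id unip_one unip_mul.
Proof. by move=> x; apply: val_inj; rewrite /= mulmx1. Qed.
Fact unip_mulVg : left_inverse unip_one unip_inv unip_mul.
Proof. by move=> x; apply: val_inj; rewrite /= mulVmx ?unip_unitmx. Qed.
Fact unip_mulgV : right_inverse unip_one unip_inv unip_mul.
Proof. by move=> x; apply: val_inj; rewrite /= mulmxV ?unip_unitmx. Qed.

HB.instance Definition _ := isGroup.Build (unip F n)
  unip_mulA unip_mul1g unip_mulg1 unip_mulVg unip_mulgV.

Fact one_plus_subproof (a : nilp F n) : 1%:M + (a : 'M_n) - 1%:M \in strict_upper F n.
Proof. by rewrite addrC addKr nvalP. Qed.
Definition one_plus (a : nilp F n) : unip F n := Unip (one_plus_subproof a).

Definition minus_one g : nilp F n := Nilp (uvalP g).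

Fact sandwich_subproof g (a : nilp F n) h : (g : 'M_n) *m a *m h \in strict_upper F n.
Proof.
have -> : (g : 'M_n) *m a *m h =
    (((uval g - 1%:M) *m a + nval a) *m (uval h - 1%:M)) + ((uval g - 1%:M) *m a + nval a).
  by rewrite mulmxBl mul1mx subrK mulmxBr mulmx1 subrK.
have hga : (uval g - 1%:M) *m a + nval a \in strict_upper F n.
  by rewrite rpredD ?strict_upper_mul ?uvalP ?nvalP.
by rewrite rpredD // strict_upper_mul ?uvalP.
Qed.
Definition sandwich g (a : nilp F n) h : nilp F n := Nilp (sandwich_subproof g a h).

(* Gamma = U_n(F) x U_n(F) acting by (g, h) . a = g a h^-1 *)
Definition act (gamma : unip F n * unip F n) (a : nilp F n) : nilp F n :=
  sandwich gamma.1 a (gamma.2^-1)%g.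

Definition superclass (a : nilp F n) : set (unip F n) :=
  [set one_plus (act gamma a) | gamma in [set: unip F n * unip F n]].

End UnipGroup.

(* The field C of scalars is instantiated with the complex numbers R[i]. *)
Definition unitary_char (C : numClosedFieldType) (V : zmodType) (chi : V -> C) : Prop :=
  (forall a b, chi (a + b) = chi a * chi b) /\ (forall a, `|chi a| = 1).

Record dual (C : numClosedFieldType) (V : zmodType) :=
  Dual { dual_fun :> V -> C; dualP : unitary_char dual_fun }.
HB.instance Definition _ C V := gen_eqMixin (dual C V).
HB.instance Definition _ C V := gen_choiceMixin (dual C V).

Section Dual.
Variable C : numClosedFieldType.

Fact trivial_char_subproof (V : zmodType) : unitary_char (fun _ : V => 1 : C).
Proof. by split=> *; rewrite ?mulr1 ?normr1. Qed.
Definition trivial_char (V : zmodType) : dual C V := Dual (trivial_char_subproof V).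

Fact dual_comp_subproof (V W : zmodType) (f : {additive V -> W}) (chi : dual C W) :
  unitary_char (fun a => chi (f a)).
Proof. by case: (dualP chi) => hD hN; split=> [a b|a]; rewrite ?raddfD ?hD ?hN. Qed.
Definition dual_comp (V W : zmodType) (f : {additive V -> W}) (chi : dual C W) :
  dual C V := Dual (dual_comp_subproof f chi).

Variables (F : fieldType) (n : nat).

Fact dual_act_subproof (gamma : unip F n * unip F n) (theta : dual C (nilp F n)) :
  unitary_char (fun a => theta (sandwich (gamma.1^-1)%g a gamma.2)).
Proof.
case: (dualP theta) => hD hN; split=> [a b|a]; rewrite ?hN // -hD.
by congr (theta _); apply: val_inj; rewrite /= mulmxDr mulmxDl.
Qed.
Definition dual_act (gamma : unip F n * unip F n) (theta : dual C (nilp F n)) :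
  dual C (nilp F n) := Dual (dual_act_subproof gamma theta).

Definition dual_orbit (theta : dual C (nilp F n)) : set (dual C (nilp F n)) :=
  [set dual_act gamma theta | gamma in [set: unip F n * unip F n]].

(* Meaningful when the orbit is finite, in particular when F is: otherwise the
   cardinal and the sum below take default values. *)
Definition orbit_average (theta : dual C (nilp F n)) (g : unip F n) : C :=
  (#|` fset_set (dual_orbit theta)|%:R)^-1 *
  \sum_(eta \in dual_orbit theta) eta (minus_one g).

End Dual.

Definition positive_definite (C : numClosedFieldType) (G : groupType) (phi : G -> C) : Prop :=
  forall (k : nat) (g : 'I_k -> G) (c : 'I_k -> C),
    0 <= \sum_i \sum_j c i * (c j)^* * phi ((g j)^-1 * g i)%g.

Definition supercharacter (C : numClosedFieldType) (F : fieldType) (n : nat)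
    (phi : unip F n -> C) : Prop :=
  [/\ positive_definite phi,
      phi 1%g = 1 &
      forall (a : nilp F n) (g h : unip F n),
        superclass a g -> superclass a h -> phi g = phi h].

Definition extreme_point (C : numClosedFieldType) (T : Type) (S : set (T -> C))
    (phi : T -> C) : Prop :=
  S phi /\
  forall (phi1 phi2 : T -> C) (t : C), S phi1 -> S phi2 -> 0 < t < 1 ->
    phi = (fun x => t * phi1 x + (1 - t) * phi2 x) -> phi1 = phi /\ phi2 = phi.

Definition indecomposable_supercharacter (C : numClosedFieldType) (F : fieldType)
    (n : nat) : (unip F n -> C) -> Prop :=
  extreme_point [set phi | supercharacter phi].

(* The set {1, ..., n} is shifted to 'I_n = {0, ..., n - 1}. *)
Record set_partition (n : nat) :=
  SetPartition { blocks :> {set {set 'I_n}};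
                 blocksP : finset.partition blocks [set: 'I_n]%SET }.

Definition arcs (n : nat) (pi : set_partition n) : {set 'I_n * 'I_n} :=
  [set a : 'I_n * 'I_n | (a.1 < a.2)%N &&
    [exists B in (pi : {set {set 'I_n}}), [&& a.1 \in B, a.2 \in B &
       ~~ [exists k in B, (a.1 < k < a.2)%N]]]]%SET.

Definition arc (n : nat) (pi : set_partition n) := {a : 'I_n * 'I_n | a \in arcs pi}.

Lemma arc_lt (n : nat) (pi : set_partition n) (a : arc pi) : ((val a).1 < (val a).2)%N.
Proof. by have := valP a; rewrite inE => /andP[]. Qed.

(* Phi n z is the set of set partitions of [n] whose arcs are labelled by elements
   of T different from z; T = k with z = 0, or T is the dual of k with z trivial. *)
Record Phi (n : nat) (T : Type) (z : T) := MkPhi {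
  part :> set_partition n;
  label : arc part -> T;
  label_neq : forall a, label a <> z }.

Definition singular (n : nat) (pi : set_partition n) : {set 'I_n * 'I_n} :=
  [set x : 'I_n * 'I_n | [exists a in arcs pi,
     ((x.1 == a.1) && (a.2 < x.2)%N) || ((x.2 == a.2) && (x.1 < a.1)%N)]]%SET.

Definition regular (n : nat) (pi : set_partition n) : {set 'I_n * 'I_n} :=
  ([set x : 'I_n * 'I_n | (x.1 < x.2)%N] :\: singular pi)%SET.

Definition nest (n : nat) (pi pi' : set_partition n) : nat :=
  (\sum_(a in arcs pi)
     #|[set b in arcs pi' | [&& a.1 < b.1, b.1 < b.2 & b.2 < a.2]]%SET|)%N.

Section Forms.
Variables (C : numClosedFieldType) (F : fieldType) (n : nat) (pi : set_partition n).

Fact arc_matrix_subproof (alpha : arc pi -> F) :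
  \sum_(a : arc pi) alpha a *: delta_mx (val a).1 (val a).2 \in strict_upper F n.
Proof.
apply: rpred_sum => a _; apply/strict_upperP => i j ji; rewrite !mxE.
case: andP => [[/eqP ei /eqP ej]|_]; last by rewrite mulr0.
by have := arc_lt a; rewrite ltnNge -ei -ej ji.
Qed.
Definition arc_matrix (alpha : arc pi -> F) : nilp F n := Nilp (arc_matrix_subproof alpha).

Fact arc_char_subproof (tau : arc pi -> dual C F) :
  unitary_char (fun b : nilp F n => \prod_(a : arc pi) tau a (nval b (val a).1 (val a).2)).
Proof.
split=> [b c|b].
  by rewrite -big_split /=; apply: eq_bigr => a _; rewrite mxE (dualP (tau a)).1.
by rewrite normr_prod big1 // => a _; rewrite (dualP (tau a)).2.
Qed.
Definition arc_char (tau : arc pi -> dual C F) : dual C (nilp F n) :=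
  Dual (arc_char_subproof tau).

End Forms.

(* Inside an algebraic closure of F_p, the subfield with q = p ^ m! elements is the
   set of solutions of x ^ q = x. *)
Definition in_level (p : nat) (p_prime : prime p) (K : fieldType)
    (iota : {rmorphism 'F_p -> K}) (m : nat) : {pred K} :=
  [pred x : K | x ^+ (p ^ m`!) == x].
Arguments in_level [p] p_prime [K] iota m.

Section Level.
Variables (p : nat) (p_prime : prime p) (K : fieldType) (iota : {rmorphism 'F_p -> K}).
Variable m : nat.

Fact in_level_divring : divring_closed (in_level p_prime iota m).
Proof.
have pK : p \in [pchar K] by apply: (rmorph_pchar iota); apply: pchar_Fp.
have pnat : [pchar K].-nat (p ^ m`!)%N.
  by rewrite pnatX (eq_pnat _ (pcharf_eq pK)) pnat_id.
split=> [|x y /eqP hx /eqP hy|x y /eqP hx /eqP hy]; rewrite inE.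
- by rewrite expr1n.
- by rewrite exprDn_pchar // exprNn_pchar // hx hy.
- by rewrite expr_div_n hx hy.
Qed.
HB.instance Definition _ :=
  GRing.isDivringClosed.Build K (in_level p_prime iota m) in_level_divring.

Record level := Level { lval :> K; lvalP : lval \in in_level p_prime iota m }.
HB.instance Definition _ := [isSub for lval].
HB.instance Definition _ := [Choice of level by <:].
HB.instance Definition _ := [SubChoice_isSubIntegralDomain of level by <:].
HB.instance Definition _ := [SubIntegralDomain_isSubField of level by <:].

Variables (C : numClosedFieldType) (n : nat).

(* The element of U_n(k_m) with the same entries as g, whenever the entries of g lie
   in k_m, which is the case for all large m if K is algebraic over F_p; the entries
   outside k_m are replaced by 0. *)
Fact descend_subproof (g : unip K n) :
  map_mx (insubd (0 : level)) (g : 'M_n) - 1%:M \in strict_upper level n.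
Proof.
apply/strict_upperP => i j ji; rewrite !mxE unipE //; apply: val_inj.
by case: eqP => _; rewrite rmorphB rmorph0 /= ?rmorph1 ?rmorph0 insubdK ?rpred1 ?rpred0 ?subrr.
Qed.
Definition descend (g : unip K n) : unip level n := Unip (descend_subproof g).

Lemma descendE (g : unip K n) :
  (forall i j, uval g i j \in in_level p_prime iota m) ->
  map_mx lval (descend g) = uval g.
Proof. by move=> hg; apply/matrixP => i j; rewrite !mxE insubdK. Qed.

(* xi^{pi, tau_m}(g); the formula makes sense even for the finitely many m for which
   some tau_m(i, j) is trivial. *)
Definition xi_level (pt : Phi n (trivial_char C K)) (g : unip K n) : C :=
  orbit_average
    (arc_char (fun a : arc pt => dual_comp (val : {additive level -> K}) (label a)))
    (descend g).

End Level.

Definition xi (p : nat) (p_prime : prime p) (K : fieldType)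
    (iota : {rmorphism 'F_p -> K}) (C : numClosedFieldType) (n : nat)
    (pt : Phi n (trivial_char C K)) (g : unip K n) : C :=
  lim (xi_level p_prime iota m pt g @[m --> \oo]).

(* Main.v *)
(* A function on U_n is a supercharacter if and only if a |-> phi (1 + a) is a normalized
   Gamma-invariant positive definite function on the additive group u_n, because
   h^-1 g - 1 = h^-1 (g - h). Let H be the subgroup of those a in u_n which, for every arc
   (i, j) of pi, vanish at all positions (k, l) <> (i, j) with i <= k and l <= j. It is stable
   under Gamma, and theta = vartheta_(pi,tau) is Gamma-invariant on H. The limit xi^(pi,tau) is
   1 + a |-> theta(a) if a is in H, and 0 otherwise.

   Both the convergence and the extremality come from one estimate, valid over any field F: if f
   is a normalized invariant positive definite function which agrees with theta on H, then
   |f a|^2 N <= 1 for all a outside H and all N <= |F|. If a vanishes at the positions (k, l)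
   with i < k < l < j, for all arcs (i, j), then an elementary row or column operation moves a by
   some h in H with theta(h) <> 1, and f(a) = f(h + a) = theta(h) f(a) gives f(a) = 0.
   Otherwise let (i, j) be an arc with i minimal such that a_kl <> 0 for some i < k < l < j; then
   f vanishes at the differences of the matrices (1 + s e_ik) a, s in F, by the first case, and
   the Cauchy-Schwarz inequality for f gives the bound.

   The estimate is applied to the orbit averages over k_m with N -> oo, and over k to the
   components of a convex decomposition of xi^(pi,tau), which agree with theta on H by strict
   convexity of the unit disc. *)
Require Import Defs.
From mathcomp Require Import all_boot all_order all_algebra finmap finfield ring.
From mathcomp Require Import all_classical all_reals topology normedtype.
From mathcomp Require Import complex.

Set Implicit Arguments.
Unset Strict Implicit.
Unset Printing Implicit Defensive.

Import Order.TTheory GRing.Theory Num.Theory.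
Import numFieldNormedType.Exports.

Local Open Scope classical_set_scope.
Local Open Scope ring_scope.

(** * Positive definite functions on an abelian group *)

Section AdditivePositiveDefinite.
Variables (C : numClosedFieldType) (V : zmodType).
Implicit Types (f : V -> C) (a b h : V).

Definition additive_pd f : Prop := forall (k : nat) (x : 'I_k -> V) (c : 'I_k -> C),
  0 <= \sum_i \sum_j c i * (c j)^* * f (x i - x j).

Variable f : V -> C.
Hypothesis f_pd : additive_pd f.

Lemma additive_pd0_ge0 : 0 <= f 0.
Proof.
have := f_pd (fun _ : 'I_1 => 0) (fun _ => 1).
by rewrite !big_ord1 conjC1 !mul1r subrr.
Qed.

(** The form at the points 0 and [a] with coefficients 1 and [c] is real, hence so is the sum of its
    two off-diagonal terms when [c] has modulus 1. The cases [c = 1] and [c = 'i] together determine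
    [f (- a)]. *)
Lemma additive_pdN a : f (- a) = (f a)^*.
Proof.
have f0 := ger0_real additive_pd0_ge0.
have real_comb (c : C) : `|c| = 1 -> c * f a + c^* * f (- a) \is Num.real.
  move=> c1.
  have := f_pd (fun i : 'I_2 => if i == 0 then 0 else a)
               (fun i : 'I_2 => if i == 0 then 1 else c).
  rewrite !big_ord_recl !big_ord0 /= !addr0 conjC1 !mul1r !mulr1 !subrr sub0r subr0.
  rewrite -normCK c1 expr1n mul1r => /ger0_real sR.
  have -> : c * f a + c^* * f (- a) =
      f 0 + c^* * f (- a) + (c * f a + f 0) - f 0 - f 0 by ring.
  by rewrite !rpredB.
have /CrealP := real_comb 1 (normr1 _); rewrite conjC1 !mul1r rmorphD /= => e1.
have /CrealP := real_comb 'i (normCi _).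
rewrite conjCi rmorphD !rmorphM /= rmorphN /= conjCi opprK => ei.
have {}ei : (f (- a))^* - (f a)^* = f a - f (- a).
  apply: (mulfI (neq0Ci C)); rewrite mulrBr mulrBr addrC -mulNr ei mulNr //.
have n2 : 2 != 0 :> C by rewrite pnatr_eq0.
apply: (mulfI n2).
have -> : 2 * f (- a) = (f a + f (- a)) - (f a - f (- a)) by ring.
by rewrite -e1 -ei; ring.
Qed.

Hypothesis f0 : f 0 = 1.

(** Adjoin the point [b] with coefficient [- z], where [z] is the sum on the left: the enlarged form
    is the old one minus the squared modulus of [z]. *)
Lemma additive_pd_Cauchy_Schwarz (k : nat) (x : 'I_k -> V) (c : 'I_k -> C) b :
  `|\sum_i c i * f (x i - b)| ^+ 2 <= \sum_i \sum_j c i * (c j)^* * f (x i - x j).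
Proof.
set z := \sum_i c i * f (x i - b).
have := f_pd (fun i : 'I_k.+1 => if unlift 0 i is Some j then x j else b)
             (fun i : 'I_k.+1 => if unlift 0 i is Some j then c j else - z).
rewrite big_ord_recl [X in X + _]big_ord_recl /= unlift_none subrr f0 mulr1.
under [X in 0 <= _ + X]eq_bigr do rewrite big_ord_recl /= unlift_none liftK.
rewrite big_split /=.
have -> : \sum_(i < k) - z * (if unlift 0 (lift 0 i) is Some j then c j else - z)^* *
    f (b - (if unlift 0 (lift 0 i) is Some j then x j else b)) = - (z * z^*).
  have -> : z^* = \sum_i (c i)^* * f (b - x i).
    rewrite rmorph_sum; apply: eq_bigr => i _.
    by rewrite rmorphM /= -additive_pdN opprB.
  rewrite -mulNr mulr_sumr; apply: eq_bigr => i _.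
  by rewrite liftK mulrA.
have -> : \sum_(i < k) c i * (- z)^* * f (x i - b) = - (z * z^*).
  rewrite mulrC rmorphN /= -mulNr /z mulr_sumr; apply: eq_bigr => i _.
  by rewrite mulrCA mulrA.
rewrite [X in _ + (_ + X)](_ : _ =
    \sum_i \sum_j c i * (c j)^* * f (x i - x j)); last first.
  by do 2 (apply: eq_bigr => ? _); rewrite liftK.
rewrite normCK rmorphN mulNr mulrN opprK addrN add0r addrC.
by rewrite subr_ge0.
Qed.

Lemma additive_pd_norm_le1 a : `|f a| <= 1.
Proof.
have := additive_pd_Cauchy_Schwarz (fun _ : 'I_1 => a) (fun _ => 1) 0.
rewrite !big_ord1 subr0 subrr conjC1 f0 !mul1r => h.
by rewrite -(ler_pXn2r (n := 2)) ?nnegrE // expr1n.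
Qed.

(** In the Cauchy-Schwarz inequality at the points [h] and 0 with coefficients 1 and [- f h], the
    right side is 1 minus the squared modulus of [f h], which is 0. *)
Lemma additive_pdD h b : `|f h| = 1 -> f (h + b) = f h * f b.
Proof.
move=> fh1.
have := additive_pd_Cauchy_Schwarz (fun i : 'I_2 => if i == 0 then h else 0)
               (fun i : 'I_2 => if i == 0 then 1 else - f h) (- b).
rewrite !big_ord_recl !big_ord0 /= !addr0 !opprK !subrr !sub0r subr0 add0r.
rewrite additive_pdN f0 conjC1 rmorphN /= !mul1r !mulr1 !mulNr mulrN opprK.
rewrite addNr addr0 -normCKC fh1 expr1n subrr.
move=> le0; have : `|f (h + b) - f h * f b| ^+ 2 = 0.
  by apply/eqP; rewrite eq_le le0 exprn_ge0.
by move/eqP; rewrite expf_eq0 /= normr_eq0 subr_eq0 => /eqP.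
Qed.

End AdditivePositiveDefinite.

(** * Arcs sharing an endpoint *)

Section Arcs.
Variables (n : nat) (pi : set_partition n).
Implicit Types x y : 'I_n * 'I_n.

Lemma arcsP x : reflect
  [/\ (x.1 < x.2)%N & exists2 B, B \in blocks pi & [/\ x.1 \in B, x.2 \in B &
     forall k, k \in B -> (x.1 < k)%N -> (x.2 <= k)%N]]
  (x \in arcs pi).
Proof.
rewrite inE; apply: (iffP andP) => -[x12].
  move=> /existsP[B /and4P[BP xB yB /existsPn no]]; split=> //; exists B => //.
  split=> // k kB xk.
  by have := no k; rewrite kB xk /= -leqNgt.
move=> [B BP [xB yB no]]; split=> //; apply/existsP; exists B; rewrite BP xB yB /=.
apply/existsPn => k; apply/negP => /and3P[kB xk ky].
by have := no k kB xk; rewrite leqNgt ky.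
Qed.

Lemma block_eq (B B' : {set 'I_n}) (i : 'I_n) :
  B \in blocks pi -> B' \in blocks pi -> i \in B -> i \in B' -> B = B'.
Proof.
have /and3P[_ /finset.trivIsetP tI _] := blocksP pi => BP B'P iB iB'.
have [//|/(tI _ _ BP B'P) /disjoint_setI0 e] := eqVneq B B'.
by have := finset.in_set0 i; rewrite -e finset.inE iB iB'.
Qed.

(** The blocks meet in the common left end, so they coincide, and each right end is the least later
    element of that block. *)
Lemma arc_eq1 x y : x \in arcs pi -> y \in arcs pi -> x.1 = y.1 -> x = y.
Proof.
case: x y => [i j] [i' j'] /arcsP[/= ij [B BP [iB jB no]]]
  /arcsP[/= ij' [B' BP' [iB' jB' no']]] e.
subst i'; have e := block_eq BP BP' iB iB'; subst B'.
by congr (_, _); apply/val_inj/eqP; rewrite eqn_leq no // no'.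
Qed.

Lemma arc_eq2 x y : x \in arcs pi -> y \in arcs pi -> x.2 = y.2 -> x = y.
Proof.
case: x y => [i j] [i' j'] /arcsP[/= ij [B BP [iB jB no]]]
  /arcsP[/= ij' [B' BP' [iB' jB' no']]] e.
subst j'; have e := block_eq BP BP' jB jB'; subst B'.
congr (_, _); apply/val_inj/eqP; rewrite eqn_leq.
apply/andP; split; rewrite leqNgt; apply/negP => lt.
  by have := no' _ iB lt; rewrite leqNgt ij.
by have := no _ iB' lt; rewrite leqNgt ij'.
Qed.

Lemma arcs_lt x : x \in arcs pi -> (x.1 < x.2)%N.
Proof. by case/arcsP. Qed.

End Arcs.

(** * Two-sided multiplication and elementary operations *)

Section Sandwich.
Variables (F : fieldType) (n : nat).
Implicit Types (u v : unip F n) (a b : Defs.nilp F n).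

Lemma sandwichA u u' a v v' :
  sandwich u (sandwich u' a v') v = sandwich (u * u')%g a (v' * v)%g.
Proof. by apply: val_inj; rewrite /= !mulmxA. Qed.

Lemma sandwich11 a : sandwich 1%g a 1%g = a.
Proof. by apply: val_inj; rewrite /= mulmx1 mul1mx. Qed.

Lemma row_operation (i k : 'I_n) (s : F) : (i < k)%N ->
  exists u, forall a r c, sandwich u a 1%g r c = a r c + s * ((r == i)%:R * a k c).
Proof.
move=> ik.
have su : s *: delta_mx i k \in strict_upper F n.
  apply/strict_upperP => r c cr; rewrite !mxE; case: eqP => [er|_]; last by rewrite mulr0.
  case: eqP => [ec|_]; last by rewrite mulr0.
  by move: cr; rewrite er ec leqNgt ik.
exists (one_plus (Nilp su)) => a r c.
rewrite /= mulmx1 mulmxDl mul1mx -scalemxAl !mxE; congr (_ + _ * _).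
rewrite (bigD1 k) //= mxE eqxx andbT big1 ?addr0 // => l lk.
by rewrite mxE (negPf lk) andbF mul0r.
Qed.

Lemma column_operation (l j : 'I_n) (s : F) : (l < j)%N ->
  exists v, forall a r c, sandwich 1%g a v r c = a r c + s * ((c == j)%:R * a r l).
Proof.
move=> lj.
have su : s *: delta_mx l j \in strict_upper F n.
  apply/strict_upperP => r c cr; rewrite !mxE; case: eqP => [er|_]; last by rewrite mulr0.
  case: eqP => [ec|_]; last by rewrite mulr0.
  by move: cr; rewrite er ec leqNgt lj.
exists (one_plus (Nilp su)) => a r c.
rewrite /= mul1mx mulmxDr mulmx1 -scalemxAr !mxE; congr (_ + _ * _).
rewrite (bigD1 l) //= mxE eqxx mulrC big1 ?addr0 // => k lk.
by rewrite mxE (negPf lk) mulr0.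
Qed.

End Sandwich.

(** * The invariant subgroup attached to the arcs *)

Section ArcRegular.
Variables (F : fieldType) (n : nat) (pi : set_partition n).
Implicit Types (u v : unip F n) (a b h : Defs.nilp F n) (x : 'I_n * 'I_n).

(** This is the subgroup H: in the closed quadrant below and to the left of an arc position, only
    the corner may be nonzero. *)
Definition arc_regular : {pred Defs.nilp F n} := [pred a : Defs.nilp F n |
  [forall x in arcs pi, [forall k : 'I_n, [forall l : 'I_n,
    [&& (x.1 <= k)%N, (l <= x.2)%N & (k, l) != x] ==> (nval a k l == 0)]]]].

Lemma arc_regularP a : reflect
  (forall x (k l : 'I_n), x \in arcs pi -> (x.1 <= k)%N -> (l <= x.2)%N ->
     (k, l) != x -> nval a k l = 0)
  (a \in arc_regular).
Proof.
apply: (iffP idP) => [/forallP h x k l xD xk lx ne|h].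
  move: (h x); rewrite xD => /forallP/(_ k)/forallP/(_ l).
  by rewrite xk lx ne => /eqP.
apply/forall_inP => x xD; apply/forallP => k; apply/forallP => l.
by apply/implyP => /and3P[xk lx ne]; rewrite (h x).
Qed.

Lemma arc_regularB a b : a \in arc_regular -> b \in arc_regular -> a - b \in arc_regular.
Proof.
move=> /arc_regularP ha /arc_regularP hb; apply/arc_regularP => x k l xD xk lx ne.
by rewrite /= !mxE (ha x) // (hb x) // subr0.
Qed.

Lemma arc_regular0 : 0 \in arc_regular.
Proof. by apply/arc_regularP => *; rewrite mxE. Qed.

(** By triangularity the entry of the product only involves positions [(k', l')] with [k <= k'] and
    [l' <= l]. These stay in the quadrant of [x], where [a] vanishes off [x], and [(k', l') = x]
    forces [(k, l) = x]. Only the diagonal term remains. *)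
Lemma arc_regular_sandwichE u a v x (k l : 'I_n) : a \in arc_regular ->
  x \in arcs pi -> (x.1 <= k)%N -> (l <= x.2)%N -> sandwich u a v k l = a k l.
Proof.
move=> /arc_regularP ha xD xk lx.
have zero k' l' : (k', l') != (k, l) -> u k k' * a k' l' * v l' l = 0.
  move=> ne; have [k'k|kk'] := ltnP k' k.
    have -> : u k k' = 0 by rewrite (unipE u (ltnW k'k)) -val_eqE /= gtn_eqF.
    by rewrite !mul0r.
  have [ll'|l'l] := ltnP l l'.
    have -> : v l' l = 0 by rewrite (unipE v (ltnW ll')) -val_eqE /= gtn_eqF.
    by rewrite mulr0.
  have [ex|nex] := eqVneq (k', l') x.
    case/eqP: ne; move: xk lx; rewrite -ex /= => xk lx.
    by congr (_, _); apply/val_inj/eqP; rewrite eqn_leq ?xk ?lx ?kk' ?l'l.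
  by rewrite (ha x) ?mulr0 ?mul0r // ?(leq_trans xk) // (leq_trans l'l).
rewrite /= mxE (bigD1 l) //= mxE (bigD1 k) //= mulrDl mulr_suml.
rewrite big1 => [|k' k'k]; last by rewrite zero // xpair_eqE negb_and k'k.
rewrite big1 => [|l' l'l].
  by rewrite !addr0 (unipE u) // (unipE v) // !eqxx mul1r mulr1.
rewrite mxE mulr_suml big1 // => k' _.
by rewrite zero // xpair_eqE negb_and l'l orbT.
Qed.

Lemma arc_regular_sandwich u a v : a \in arc_regular -> sandwich u a v \in arc_regular.
Proof.
move=> ha; apply/arc_regularP => x k l xD xk lx ne.
by rewrite (arc_regular_sandwichE _ _ ha xD) //; move/arc_regularP: ha => /(_ x); apply.
Qed.

Lemma arc_char_sandwich (C : numClosedFieldType) (tau : Defs.arc pi -> dual C F) u a v :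
  a \in arc_regular -> arc_char tau (sandwich u a v) = arc_char tau a.
Proof.
move=> ha; apply: eq_bigr => x _; congr (tau x _).
exact: arc_regular_sandwichE ha (valP x) _ _.
Qed.

End ArcRegular.

Lemma dual0 (C : numClosedFieldType) (V : zmodType) (chi : dual C V) : chi 0 = 1.
Proof.
have [chiD chiN] := dualP chi; have := chiD 0 0; rewrite addr0 => e.
have nz : chi 0 != 0 by rewrite -normr_gt0 chiN.
by apply: (mulfI nz); rewrite -e mulr1.
Qed.

(** * The decay estimate outside the subgroup *)

Section Decay.
Variables (C : numClosedFieldType) (F : fieldType) (n : nat) (pi : set_partition n).
Variables (tau : Defs.arc pi -> dual C F) (f : Defs.nilp F n -> C).
Hypothesis tau_neq1 : forall x, exists s, tau x s != 1.
Hypothesis f_pd : additive_pd f.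
Hypothesis f0 : f 0 = 1.
Hypothesis f_sandwich : forall u a v, f (sandwich u a v) = f a.
Hypothesis f_regular : forall h, h \in arc_regular pi -> f h = arc_char tau h.
Implicit Types (a h : Defs.nilp F n).

Lemma sandwich_shift_eq0 u a v : sandwich u a v - a \in arc_regular pi ->
  arc_char tau (sandwich u a v - a) != 1 -> f a = 0.
Proof.
set h := sandwich u a v - a => hr hn1.
have fh1 : `|f h| = 1 by rewrite f_regular // (dualP (arc_char tau)).2.
have := additive_pdD f_pd f0 a fh1; rewrite {1}/h subrK f_sandwich (f_regular hr) => e.
apply/eqP; apply: contraNT hn1 => fa.
by apply/eqP/(mulIf fa); rewrite mul1r -e.
Qed.

Lemma arc_char_single (x : Defs.arc pi) h :
  (forall y : Defs.arc pi, y != x -> nval h (val y).1 (val y).2 = 0) ->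
  arc_char tau h = tau x (nval h (val x).1 (val x).2).
Proof.
move=> h0; rewrite /= (bigD1 x) //= big1 ?mulr1 // => y yx.
by rewrite h0 // dual0.
Qed.

Definition arc_interior_zero a : Prop := forall x (k l : 'I_n),
  x \in arcs pi -> (x.1 < k)%N -> (l < x.2)%N -> nval a k l = 0.

Lemma arc_interior_zero_eq0 a :
  arc_interior_zero a -> a \notin arc_regular pi -> f a = 0.
Proof.
move=> a0 /forall_inPn[x xD /forallPn[k /forallPn[l]]].
rewrite negb_imply => /andP[/and3P[xk lx ne] akl].
pose x' : Defs.arc pi := exist _ x xD.
(* With this factor, the operation below changes the entry at the arc [x] by exactly [s0], where
   [tau x'] differs from 1. The offending position lies on the border of the quadrant: in row [x.1]
   (column operation) or in column [x.2] (row operation). *)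
have [s0 s0P] := tau_neq1 x'; set s := s0 / nval a k l.
have [xk'|] := ltnP x.1 k; last first.
- move=> kx; have {kx xk} ek : k = x.1 by apply/val_inj/eqP; rewrite eqn_leq kx.
  have {}lx : (l < x.2)%N.
    rewrite ltn_neqAle lx andbT; apply: contraNneq ne => /val_inj ->.
    by rewrite ek -surjective_pairing.
  have [v vP] := column_operation s lx.
  have hE (r c : 'I_n) : nval (sandwich 1%g a v - a) r c = s * ((c == x.2)%:R * a r l).
    by rewrite /= mxE [X in X + _]vP mxE addrAC subrr add0r.
  apply: (@sandwich_shift_eq0 1%g a v).
    apply/arc_regularP => y k' l' yD yk ly ney; rewrite hE.
    case: eqP => [el|_]; rewrite ?mul0r ?mulr0 // mul1r.
    have ly' : (l < y.2)%N by apply: leq_trans lx _; rewrite -el.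
    move: yk; rewrite leq_eqVlt => /predU1P[yk|yk]; last by rewrite (a0 y) ?mulr0.
    have {}yk : y.1 = k' by apply: val_inj.
    have yx : y.1 != x.1.
      apply: contraNneq ney => e; rewrite (arc_eq1 yD xD e) in yk *.
      by rewrite el -yk -surjective_pairing.
    (* If [y] starts before [x], the nonzero entry [(k, l)] lies strictly inside [y], against [a0];
       if it starts after [x], then [(k', l)] lies strictly inside [x], so the entry vanishes. *)
    have [lt|] := ltnP y.1 x.1.
      by case/eqP: akl; apply: (a0 y); rewrite // ek.
    rewrite leq_eqVlt eq_sym (negPf yx : (val _ == val _) = _) /= => lt.
    by rewrite (a0 x) ?mulr0 // -yk.
  (* The difference lives in column [x.2], which contains no other arc, so only the factor of [x']
     survives. *)
  rewrite (@arc_char_single x') => [|y]; first last.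
    rewrite -val_eqE hE => yx; case: eqP; rewrite ?mul0r ?mulr0 // => e.
    by case/eqP: yx; apply: arc_eq2 (valP y) xD e.
  by rewrite hE /= eqxx mul1r -ek /s divfK.
(* The mirror case: rows and columns exchange roles. *)
have {lx} el : l = x.2.
  apply/val_inj/eqP; rewrite eqn_leq lx leqNgt; apply: contra akl => lx'.
  by apply/eqP/(a0 x).
have [u uP] := row_operation s xk'.
have hE (r c : 'I_n) : nval (sandwich u a 1%g - a) r c = s * ((r == x.1)%:R * a k c).
  by rewrite /= mxE [X in X + _]uP mxE addrAC subrr add0r.
apply: (@sandwich_shift_eq0 u a 1%g).
  apply/arc_regularP => y k' l' yD yk ly ney; rewrite hE.
  case: eqP => [ek|_]; rewrite ?mul0r ?mulr0 // mul1r.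
  have yk' : (y.1 < k)%N by apply: leq_ltn_trans xk'; rewrite -ek.
  move: ly; rewrite leq_eqVlt => /predU1P[ly|ly]; last by rewrite (a0 y) ?mulr0.
  have {}ly : y.2 = l' by apply: val_inj.
  have yx : y.2 != x.2.
    apply: contraNneq ney => e; rewrite (arc_eq2 yD xD e) in ly *.
    by rewrite ek -ly -surjective_pairing.
  have [lt|] := ltnP x.2 y.2.
    by case/eqP: akl; apply: (a0 y); rewrite // el.
  rewrite leq_eqVlt (negPf yx : (val _ == val _) = _) /= => lt.
  by rewrite (a0 x) ?mulr0 // -ly.
rewrite (@arc_char_single x') => [|y]; first last.
  rewrite -val_eqE hE => yx; case: eqP; rewrite ?mul0r ?mulr0 // => e.
  by case/eqP: yx; apply: arc_eq1 (valP y) xD e.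
by rewrite hE /= eqxx mul1r -el /s divfK.
Qed.

Lemma irregular_decay a (s : seq F) :
  uniq s -> a \notin arc_regular pi -> `|f a| ^+ 2 * (size s)%:R <= 1.
Proof.
move=> us aN.
pose bad (x : 'I_n * 'I_n) :=
  [exists k : 'I_n, [exists l : 'I_n, [&& (x.1 < k)%N, (l < x.2)%N & nval a k l != 0]]].
have [[x0 /andP[x0D x0b]]|nobad] := pselect (exists x, (x \in arcs pi) && bad x);
    last first.
  rewrite arc_interior_zero_eq0 ?normr0 ?expr0n ?mul0r //.
  move=> x k l xD xk lx; apply/eqP/negP => /negP akl; apply: nobad; exists x.
  by rewrite xD; apply/existsP; exists k; apply/existsP; exists l; rewrite xk lx.
pose P x := (x \in arcs pi) && bad x.
have P0 : P x0 by rewrite /P x0D.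
case: (arg_minnP (fun x => nat_of_ord x.1) P0) => x /andP[xD].
move=> /existsP[k /existsP[l /and3P[xk lx akl]]] xmin.
have [u uP] := choice (fun t : F => @row_operation F n x.1 k t xk).
set N := size s; have [->|Npos] := posnP N; first by rewrite mulr0.
have Nn0 : N%:R != 0 :> C by rewrite pnatr_eq0 -lt0n.
(* The difference is [t - t'] times row [k] of [a], placed in row [x.1]. A nonzero entry of it
   strictly inside an arc [y] would make [y] bad with [y.1 < x.1], against minimality; its nonzero
   entry at [(x.1, l)] keeps it out of H. *)
have cross t t' : t != t' -> f (sandwich (u t) a 1%g - sandwich (u t') a 1%g) = 0.
  move=> tt'; set b := _ - _.
  have bE (r c : 'I_n) : nval b r c = (t - t') * ((r == x.1)%:R * a k c).
    have -> : nval b r c =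
      sandwich (u t) a 1%g r c - sandwich (u t') a 1%g r c by rewrite /b /= !mxE.
    by rewrite !uP; ring.
  apply: arc_interior_zero_eq0.
    move=> y k' l' yD yk ly; rewrite bE; case: eqP => [ek|_]; rewrite ?mul0r ?mulr0 //.
    rewrite mul1r; have yx : (y.1 < x.1)%N by rewrite -ek.
    suff -> : a k l' = 0 by rewrite mulr0.
    apply/eqP/negP => /negP akl'; suff /xmin : P y by rewrite leqNgt yx.
    rewrite /P yD; apply/existsP; exists k.
    by apply/existsP; exists l'; rewrite (ltn_trans yx xk) ly.
  apply/negP => /arc_regularP/(_ x x.1 l xD (leqnn _) (ltnW lx)).
  have -> : (x.1, l) != x.
    by apply: contraTneq lx => <-; rewrite ltnn.
  move=> /(_ isT) /eqP; rewrite bE eqxx mul1r.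
  by rewrite mulf_eq0 subr_eq0 (negPf tt') (negPf akl).
(* With equal weights [N%:R^-1] the left side is the squared modulus of [f a] by invariance, and on
   the right only the [N] diagonal terms remain. *)
have := additive_pd_Cauchy_Schwarz f_pd f0
  (fun i : 'I_N => sandwich (u s`_i) a 1%g) (fun=> N%:R^-1) 0.
under eq_bigr do rewrite subr0 f_sandwich.
rewrite sumr_const card_ord -[X in `|X|]mulr_natl mulrA divff // mul1r.
have -> : \sum_(i < N) \sum_(j < N) N%:R^-1 * (N%:R^-1)^* *
    f (sandwich (u s`_i) a 1%g - sandwich (u s`_j) a 1%g) = N%:R^-1.
  rewrite (eq_bigr (fun=> N%:R^-1 * N%:R^-1)) => [|i _].
    by rewrite sumr_const card_ord -[LHS]mulr_natl mulrA divff // mul1r.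
  rewrite (bigD1 i) //= big1 => [|j ji].
    by rewrite subrr f0 addr0 mulr1 fmorphV rmorph_nat.
  rewrite cross ?mulr0 // nth_uniq //; by rewrite eq_sym.
by rewrite -(ler_pM2r (x := N%:R)) ?ltr0n // mulVf.
Qed.

End Decay.

(** * Characters of abelian groups and of their subgroups *)

Section DualGroup.
Variable C : numClosedFieldType.

Lemma dual_inj (V : zmodType) (chi psi : dual C V) : dual_fun chi =1 dual_fun psi -> chi = psi.
Proof.
case: chi psi => [f fP] [g gP] /= /funext e; subst g.
by congr Dual; exact: Prop_irrelevance.
Qed.

Lemma dualB (V : zmodType) (chi : dual C V) a b : chi (a - b) = chi a * (chi b)^*.
Proof.
have [chiD chiN] := dualP chi; rewrite chiD; congr (_ * _).
have nz : chi b != 0 by rewrite -normr_gt0 chiN.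
apply: (mulfI nz); rewrite -normCK chiN expr1n -chiD subrr.
exact: dual0.
Qed.

Lemma dual_form (V : zmodType) (chi : dual C V) k (x : 'I_k -> V) (c : 'I_k -> C) :
  \sum_i \sum_j c i * (c j)^* * chi (x i - x j) = `|\sum_i c i * chi (x i)| ^+ 2.
Proof.
rewrite normCK rmorph_sum /= mulr_suml; apply: eq_bigr => i _.
rewrite mulr_sumr; apply: eq_bigr => j _.
by rewrite dualB rmorphM /=; ring.
Qed.

(** Points in different cosets of [H] do not interact, and each coset contributes a squared
    modulus. *)
Lemma subgroup_char_pd (V : zmodType) (H : {pred V}) (chi : dual C V) :
  zmod_closed H -> additive_pd (fun a => if a \in H then chi a else 0).
Proof.
move=> [H0 HB] k x c.
(* A chosen index in the coset of [x i]; it depends on the coset only. The default is never reached,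
   since [i] itself qualifies. *)
pose r i : 'I_k := odflt i [pick j | x i - x j \in H].
have rP i j : (r i == r j) = (x i - x j \in H).
  have rx l : x l - x (r l) \in H.
    rewrite /r; case: pickP => //= _; by rewrite subrr.
  have HN a : a \in H -> - a \in H by rewrite -sub0r; apply: HB.
  apply/eqP/idP => [e|xij].
    by have := HB _ _ (rx i) (rx j); rewrite e opprB addrA subrK.
  rewrite /r (@eq_pick _ _ (fun l => x j - x l \in H)); last first.
    move=> l /=; apply/idP/idP => h.
      by have := HB _ _ h xij; rewrite opprB addrC addrA subrK.
    by have := HB _ _ h (HN _ xij); rewrite opprK addrC addrA subrK.
  by case: pickP => // /(_ j); rewrite subrr H0.
suff -> : \sum_i \sum_j c i * (c j)^* * (if x i - x j \in H then chi (x i - x j) else 0) =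
    \sum_m `|\sum_(i | r i == m) c i * chi (x i)| ^+ 2.
  by apply: sumr_ge0 => m _; rewrite exprn_ge0.
under [RHS]eq_bigr => m _.
  rewrite normCK rmorph_sum /= mulr_suml; over.
rewrite [RHS](exchange_big_dep xpredT) //=; apply: eq_bigr => i _.
rewrite [RHS](big_pred1 (r i)) => [|m]; last by rewrite /= eq_sym.
rewrite mulr_sumr [RHS]big_mkcond; apply: eq_bigr => j _ /=.
rewrite eq_sym rP; case: ifP => _; rewrite ?mulr0 // dualB rmorphM /=; ring.
Qed.

End DualGroup.

(** * Supercharacters as invariant functions, and orbit averages *)

Section InvariantFunctions.
Variables (C : numClosedFieldType) (F : fieldType) (n : nat).

Lemma one_plusK : cancel (@one_plus F n) (@minus_one F n).
Proof. by move=> a; apply: val_inj; rewrite /= addrC addKr. Qed.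

Lemma minus_oneK : cancel (@minus_one F n) (@one_plus F n).
Proof. by move=> g; apply: val_inj; rewrite /= addrC subrK. Qed.

Lemma minus_one1 : minus_one (1%g : unip F n) = 0.
Proof. by apply: val_inj; rewrite /= subrr. Qed.

Lemma minus_one_mulV (g h : unip F n) :
  minus_one (h^-1 * g)%g = sandwich (h^-1)%g (minus_one g - minus_one h) 1%g.
Proof.
apply: val_inj; rewrite /= mulmx1 opprB addrA subrK mulmxBr.
by rewrite mulVmx // unip_unitmx.
Qed.

Lemma supercharacter_one_plus (phi : unip F n -> C) : supercharacter phi ->
  [/\ additive_pd (phi \o @one_plus F n), phi (one_plus 0) = 1 &
      forall u a v, phi (one_plus (sandwich u a v)) = phi (one_plus a)].
Proof.
move=> [phi_pd phi1 phi_cst].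
have phi_sandwich u a v : phi (one_plus (sandwich u a v)) = phi (one_plus a).
  apply: (phi_cst a); last first.
    by exists (1%g, 1%g) => //; rewrite /act /= invg1 sandwich11.
  by exists (u, v^-1)%g => //; rewrite /act /= invgK.
split=> //; last by rewrite -minus_one1 minus_oneK.
move=> k x c; have := phi_pd k (fun i => one_plus (x i)) c.
congr (0 <= _); do 2 (apply: eq_bigr => ? _); congr (_ * _).
by rewrite -[X in phi X]minus_oneK minus_one_mulV phi_sandwich !one_plusK.
Qed.

Lemma minus_one_supercharacter (f : Defs.nilp F n -> C) :
  additive_pd f -> f 0 = 1 -> (forall u a v, f (sandwich u a v) = f a) ->
  supercharacter (f \o @minus_one F n).
Proof.
move=> f_pd f0 f_sandwich; split.
- move=> k g c; have := f_pd k (fun i => minus_one (g i)) c.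
  congr (0 <= _); do 2 (apply: eq_bigr => ? _); congr (_ * _).
  by rewrite /= minus_one_mulV f_sandwich.
- by rewrite /= minus_one1.
- by move=> a _ _ [[u v] _ <-] [[u' v'] _ <-]; rewrite /= !one_plusK !f_sandwich.
Qed.

Variable theta : dual C (Defs.nilp F n).
Hypothesis orbit_finite : finite_set (dual_orbit theta).

Lemma dual_act_orbit gamma eta : dual_orbit theta eta -> dual_orbit theta (dual_act gamma eta).
Proof.
move=> [[u v] _ <-]; case: gamma => u' v'; exists (u' * u, v' * v)%g => //.
by apply: dual_inj => a /=; rewrite sandwichA invgM.
Qed.

Let N := #|` fset_set (dual_orbit theta)|.

Lemma orbit_card_neq0 : N%:R != 0 :> C.
Proof.
rewrite pnatr_eq0 -lt0n; rewrite cardfs_gt0.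
apply/fset0Pn; exists theta; rewrite in_fset_set // inE; exists (1%g, 1%g) => //.
by apply: dual_inj => a; rewrite /= invg1 sandwich11.
Qed.

Lemma orbit_averageE a : orbit_average theta (one_plus a) =
  N%:R^-1 * \sum_(eta <- fset_set (dual_orbit theta)) eta a.
Proof. by rewrite /orbit_average fsbig_finite //= one_plusK. Qed.

Lemma orbit_average_pd : additive_pd (fun a => orbit_average theta (one_plus a)).
Proof.
move=> k x c.
suff -> : \sum_i \sum_j c i * (c j)^* * orbit_average theta (one_plus (x i - x j)) =
    N%:R^-1 * \sum_(eta <- fset_set (dual_orbit theta)) `|\sum_i c i * eta (x i)| ^+ 2.
  by rewrite mulr_ge0 ?invr_ge0 ?ler0n // sumr_ge0 // => eta _; rewrite exprn_ge0.
under [X in _ = _ * X]eq_bigr do rewrite -dual_form.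
rewrite [X in _ = _ * X]exchange_big mulr_sumr; apply: eq_bigr => i _.
rewrite [X in _ = _ * X]exchange_big mulr_sumr; apply: eq_bigr => j _.
by rewrite orbit_averageE -mulr_sumr; ring.
Qed.

(** Moving the argument by [u] and [v] amounts to permuting the orbit by [dual_act (u^-1, v)]. *)
Lemma orbit_average_sandwich u a v :
  orbit_average theta (one_plus (sandwich u a v)) = orbit_average theta (one_plus a).
Proof.
rewrite /orbit_average !one_plusK; congr (_ * _).
have bij : set_bij (dual_orbit theta) (dual_orbit theta) (dual_act (u^-1, v)%g).
  have K : cancel (dual_act (u^-1, v)%g) (dual_act (u, v^-1)%g : dual C _ -> _).
    by move=> eta; apply: dual_inj => b /=; rewrite sandwichA invgK mulgV mulVg sandwich11.
  have K' : cancel (dual_act (u, v^-1)%g : dual C _ -> _) (dual_act (u^-1, v)%g).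
    by move=> eta; apply: dual_inj => b /=; rewrite sandwichA invgK mulgV mulVg sandwich11.
  split=> [eta|eta eta' _ _ /(can_inj K)//|eta etaP].
    exact: dual_act_orbit.
  by exists (dual_act (u, v^-1)%g eta); rewrite ?K' //; apply: dual_act_orbit.
rewrite [RHS](reindex_fsbig _ _ _ _ bij); apply: eq_fsbigr => eta _ /=.
by rewrite invgK.
Qed.

(** All characters of the orbit take the same value at such an [a]. This evaluates the averages on
    H. *)
Lemma orbit_average_fixed a : (forall u v, theta (sandwich u a v) = theta a) ->
  orbit_average theta (one_plus a) = theta a.
Proof.
move=> fixed; rewrite orbit_averageE (eq_big_seq (fun=> theta a)).
  by rewrite big_const_seq count_predT iter_addr_0 -[X in _ * X]mulr_natl mulrA
    mulVf ?mul1r ?orbit_card_neq0.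
by move=> eta; rewrite in_fset_set // inE => -[gamma _ <-]; apply: fixed.
Qed.

End InvariantFunctions.

(** * Finiteness and archimedean facts *)

Lemma dual_orbit_finite (C : numClosedFieldType) (F : fieldType) (n : nat)
    (theta : dual C (Defs.nilp F n)) :
  finite_set [set: F] -> finite_set (dual_orbit theta).
Proof.
move=> /finite_seqP[s sP].
pose M : finType := {ffun 'I_n * 'I_n -> seq_sub s}.
(* Arrays that are not unipotent are sent to 1; this is harmless, as only surjectivity matters. *)
pose toU (q : M) : unip F n :=
  insubd (1%g : unip F n) (\matrix_(i, j) val (q (i, j)) : 'M[F]_n).
have ins (x : F) : x \in s by have : [set: F] x by []; rewrite sP.
have toUP g : exists q, toU q = g.
  exists [ffun x => SeqSub (ins (uval g x.1 x.2))]; apply: val_inj; rewrite insubdK.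
    by apply/matrixP => i j; rewrite mxE ffunE.
  have -> : \matrix_(i, j) val ([ffun x => SeqSub (ins (uval g x.1 x.2))] (i, j)) = uval g.
    by apply/matrixP => i j; rewrite mxE ffunE.
  exact: uvalP.
apply: (@sub_finite_set _ _ ((fun q : M * M => dual_act (toU q.1, toU q.2) theta) @` setT)).
  move=> _ [[u v] _ <-]; have [q <-] := toUP u; have [q' <-] := toUP v.
  by exists (q, q').
by apply: finite_image; exact: finite_finset.
Qed.

Lemma closed_field_infinite (K : closedFieldType) (N : nat) :
  exists s : seq K, uniq s /\ size s = N.
Proof.
elim: N => [|N [s [us sz]]]; first by exists [::].
have /closed_nonrootP[z] : \prod_(x <- s) ('X - x%:P) != 0 :> {poly K}.
  by rewrite monic_neq0 // monic_prod_XsubC.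
by rewrite root_prod_XsubC => zs; exists (z :: s); rewrite /= zs us sz.
Qed.

Lemma complex_archimedean (R : realType) (eps : R[i]) :
  0 < eps -> exists N : nat, 1 < eps ^+ 2 * N%:R.
Proof.
case: eps => e f; rewrite ltcE /= => /andP[/eqP f0 e0]; subst f.
have e2 : 0 < e ^+ 2 by rewrite exprn_gt0.
exists (Num.bound (e ^+ 2)^-1).
have : (e ^+ 2)^-1 < (Num.bound (e ^+ 2)^-1)%:R.
  by apply: le_lt_trans (archi_boundP _); rewrite ?ler_norm // invr_ge0 ltW.
rewrite -(ltr_pM2l e2) divff ?gt_eqF // => h.
have : (1 : R)%:C%C < ((e ^+ 2) * (Num.bound (e ^+ 2)^-1)%:R)%:C%C by rewrite ltcR.
by rewrite rmorphM rmorphXn rmorph_nat.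
Qed.

(** * The finite subfields of the algebraic closure *)

Section Levels.
Variables (p : nat) (p_prime : prime p) (K : closedFieldType).
Variables (iota : {rmorphism 'F_p -> K}) (K_alg : forall x : K, algebraicOver iota x).

Let pK : p \in [pchar K].
Proof. by apply: (rmorph_pchar iota); apply: pchar_Fp. Qed.

Let frob k (x : K) := x ^+ (p ^ k).

Let frobS k x : frob k.+1 x = frob k x ^+ p.
Proof. by rewrite /frob -exprM expnSr. Qed.

(** The Frobenius iterates of [x] are roots of one nonzero polynomial over the prime field, so two
    of them coincide, and by injectivity [x] is fixed by some iterate [d > 0]. Then [d] divides the
    factorial of every [m >= d]. *)
Lemma in_level_near (x : K) : \forall m \near \oo, x \in in_level p_prime iota m.
Proof.
have frob_inj k : injective (frob k).
  elim: k => [|k IH] y z; first by rewrite /frob !expr1.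
  by rewrite !frobS => /(fmorph_inj (pFrobenius_aut pK))/IH.
suff [d d0 xd] : exists2 d, (0 < d)%N & frob d x = x.
  exists d => // m /= dm; rewrite inE.
  have /dvdnP[q ->] : (d %| m`!)%N by rewrite dvdn_fact // d0.
  apply/eqP; elim: q => [|q IH]; first by rewrite mul0n expr1.
  by rewrite mulSn expnD exprM -/(frob d x) xd IH.
have [q q0 qx] := K_alg x.
have rootq k : root (map_poly iota q) (frob k x).
  elim: k => [|k IH]; first by rewrite /frob expr1.
  rewrite frobS -[_ ^+ p]/(pFrobenius_aut pK _).
  have -> : map_poly iota q = map_poly (pFrobenius_aut pK) (map_poly iota q).
    apply/polyP => i; rewrite !coef_map /= pFrobenius_autE -rmorphXn /=.
    by have := expf_card q`_i; rewrite card_Fp // => ->.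
  by rewrite fmorph_root.
(* [size q] is one more than the degree, so this many iterates cannot be distinct roots. *)
have [u|] := boolP (uniq [seq frob k x | k <- seq.iota 0 (size q)]).
  have mq0 : map_poly iota q != 0 by rewrite map_poly_eq0.
  have /(max_poly_roots mq0)/(_ u) :
      all (root (map_poly iota q)) [seq frob k x | k <- seq.iota 0 (size q)].
    by apply/allP => _ /mapP[k _ ->].
  by rewrite size_map size_iota size_map_poly ltnn.
move=> /(uniqPn 0)[i [j [ij]]]; rewrite size_map size_iota => jq.
rewrite !(nth_map 0) ?size_iota ?(ltn_trans ij) // !nth_iota ?(ltn_trans ij) // !add0n.
move=> e; exists (j - i)%N; first by rewrite subn_gt0.
apply: (frob_inj i); rewrite e /frob -exprM -expnD subnK // ltnW //.
Qed.

Lemma in_level_near_all (I : finType) (x : I -> K) :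
  \forall m \near \oo, forall i, x i \in in_level p_prime iota m.
Proof. by apply: filter_forall => i; apply: in_level_near. Qed.

Lemma level_finite m : finite_set [set: level p_prime iota m].
Proof.
(* Factorials are positive, even at [m = 0]; hence the terms of [P] below do not cancel. *)
have q1 : (1 < p ^ m`!)%N by rewrite -(expn0 p) ltn_exp2l ?prime_gt1 ?fact_gt0.
pose P : {poly K} := 'X^(p ^ m`!) - 'X.
have P0 : P != 0.
  by rewrite -size_poly_eq0 size_polyDl size_polyXn // size_polyN size_polyX ltnS.
have [rs Prs] := closed_field_poly_normal P.
have lc : lead_coef P != 0 by rewrite lead_coef_eq0.
apply/finite_seqP; exists [seq insubd (0 : level p_prime iota m) z | z <- rs].
apply/seteqP; split => // y _ /=; apply/mapP; exists (lval y); last by rewrite valKd.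
rewrite -root_prod_XsubC -(rootZ _ _ lc) -Prs rootE !hornerE subr_eq0.
exact: lvalP.
Qed.

(** Any [N] distinct elements of [K] eventually lie in the level, so its cardinality need not be
    computed. *)
Lemma level_size_near N : \forall m \near \oo,
  exists s : seq (level p_prime iota m), uniq s /\ size s = N.
Proof.
have [s [us sN]] := closed_field_infinite K N.
have := in_level_near_all (fun i : 'I_(size s) => s`_i).
apply: filterS => m ms; exists [seq insubd (0 : level p_prime iota m) z | z <- s].
rewrite size_map sN; split=> //; rewrite map_inj_in_uniq // => y z ys zs.
have lev t : t \in s -> t \in in_level p_prime iota m.
  by move=> ts; have := ms (Ordinal (etrans (index_mem t s) ts)); rewrite /= nth_index.
by move=> /(congr1 val); rewrite !insubdK ?lev.
Qed.

End Levels.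

(** * The limit function *)

Section Limit.
Variables (C : numClosedFieldType) (F : fieldType) (n : nat).
Variable pt : Phi n (trivial_char C F).

Definition xi_limit (a : Defs.nilp F n) : C :=
  if a \in arc_regular pt then arc_char (label (p := pt)) a else 0.

Lemma xi_limit_pd : additive_pd xi_limit.
Proof.
apply: subgroup_char_pd; split; first exact: arc_regular0.
by move=> a b; apply: arc_regularB.
Qed.

Lemma xi_limit0 : xi_limit 0 = 1.
Proof. by rewrite /xi_limit arc_regular0 dual0. Qed.

Lemma xi_limit_sandwich u a v : xi_limit (sandwich u a v) = xi_limit a.
Proof.
have reg a' u' v' := @arc_regular_sandwich F n pt u' a' v'.
have e : (sandwich u a v \in arc_regular pt) = (a \in arc_regular pt).
  apply/idP/idP; last exact: reg.
  by move/(reg _ u^-1 v^-1)%g; rewrite sandwichA mulVg mulgV sandwich11.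
by rewrite /xi_limit e; case: ifP => // aR; rewrite arc_char_sandwich.
Qed.

Lemma label_neq1 x : exists s, label (p := pt) x s != 1.
Proof.
apply/not_existsP => all1; apply: (label_neq (p := pt) (a := x)).
by apply: dual_inj => s; apply/eqP/negP => /negP; apply: all1.
Qed.

End Limit.

(** * Extremality *)

Lemma convex_unit_eq (C : numClosedFieldType) (t w z1 z2 : C) : 0 < t < 1 ->
  `|w| = 1 -> `|z1| <= 1 -> `|z2| <= 1 -> w = t * z1 + (1 - t) * z2 -> z1 = w.
Proof.
move=> /andP[t0 t1] w1 z11 z21 e.
have wn0 : w^* != 0 by rewrite conjC_eq0 -normr_eq0 w1 oner_neq0.
pose z (i : 'I_2) := if i == 0 then z1 else z2.
pose s (i : 'I_2) := if i == 0 then t else 1 - t.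
have s0 i : 0 < s i by rewrite /s; case: ifP => _ //; rewrite subr_gt0.
have le i : xpredT i -> `|w^* * (s i * z i)| <= s i.
  move=> _; rewrite !normrM norm_conjC w1 mul1r gtr0_norm // ger_pMr //.
  by rewrite /z; case: ifP.
have sum : \sum_i w^* * (s i * z i) = \sum_i s i.
  rewrite -mulr_sumr !big_ord_recl !big_ord0 /= !addr0 -e mulrC -normCK w1.
  by rewrite expr1n addrC subrK.
have := normC_sum_upper le sum (isT : xpredT (ord0 : 'I_2)); rewrite /s /z /= mulrCA => h.
have {}h : w^* * z1 = 1 by apply: (mulfI (lt0r_neq0 t0)); rewrite h mulr1.
by apply: (mulfI wn0); rewrite h mulrC -normCK w1 expr1n.
Qed.

Section Extremality.
Variables (R : realType) (F : fieldType) (n : nat) (pt : Phi n (trivial_char R[i] F)).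
Hypothesis F_infinite : forall N, exists s : seq F, uniq s /\ size s = N.

(** A nonzero value [z] off H would violate the decay estimate for [N] elements of [F], once [N]
    times the squared modulus of [z] exceeds 1. *)
Lemma supercharacter_unique (phi : unip F n -> R[i]) : supercharacter phi ->
  (forall h, h \in arc_regular pt -> phi (one_plus h) = arc_char (label (p := pt)) h) ->
  phi = xi_limit pt \o @minus_one F n.
Proof.
move=> /supercharacter_one_plus[pd f0 inv] phiR; apply/funext => g /=.
rewrite -[in LHS](minus_oneK g) /xi_limit; case: ifPn => [/phiR //|aN].
set z := phi _; apply/eqP; apply: contraT => z0.
have [N zN] := complex_archimedean (etrans (normr_gt0 z) z0).
have [s [us sN]] := F_infinite N.
have := irregular_decay (@label_neq1 _ _ _ pt) pd f0 inv phiR us aN.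
by rewrite sN => /(lt_le_trans zN); rewrite ltxx.
Qed.

Lemma xi_limit_indecomposable :
  indecomposable_supercharacter (xi_limit pt \o @minus_one F n).
Proof.
split.
  exact: minus_one_supercharacter (@xi_limit_pd _ _ _ pt) (xi_limit0 pt)
    (@xi_limit_sandwich _ _ _ pt).
move=> phi1 phi2 t S1 S2 t01 e.
have [pd1 f01 _] := supercharacter_one_plus S1.
have [pd2 f02 _] := supercharacter_one_plus S2.
have eR h : h \in arc_regular pt -> arc_char (label (p := pt)) h =
    t * phi1 (one_plus h) + (1 - t) * phi2 (one_plus h).
  by move=> hR; have := congr1 (@^~ (one_plus h)) e; rewrite /= one_plusK /xi_limit hR.
have n1 h := (dualP (arc_char (label (p := pt)))).2 h.
have le1 h := additive_pd_norm_le1 pd1 f01 h.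
have le2 h := additive_pd_norm_le1 pd2 f02 h.
split; apply: supercharacter_unique => // h /eR eh.
  exact: convex_unit_eq t01 (n1 h) (le1 h) (le2 h) eh.
have t01' : 0 < 1 - t < 1.
  by case/andP: t01 => t0 t1; rewrite subr_gt0 t1 gtrBl.
by apply: convex_unit_eq t01' (n1 h) (le2 h) (le1 h) _; rewrite subKr addrC.
Qed.

End Extremality.

(** * Convergence of the orbit averages *)

Section Convergence.
Variables (R : realType) (p : nat) (p_prime : prime p) (K : closedFieldType).
Variables (iota : {rmorphism 'F_p -> K}) (K_alg : forall x : K, algebraicOver iota x).
Variables (n : nat) (pt : Phi n (trivial_char R[i] K)).

Let level_label m (x : Defs.arc pt) : dual R[i] (level p_prime iota m) :=
  dual_comp (val : {additive level p_prime iota m -> K}) (label x).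

Let entries_in_level m (g : unip K n) :=
  forall i j, uval g i j \in in_level p_prime iota m.

Lemma entries_in_level_near g : \forall m \near \oo, entries_in_level m g.
Proof.
have := @in_level_near_all p p_prime K iota K_alg _ (fun x : 'I_n * 'I_n => uval g x.1 x.2).
by apply: filterS => m h i j; apply: (h (i, j)).
Qed.

Lemma level_label_neq1_near : \forall m \near \oo, forall x, exists s, level_label m x s != 1.
Proof.
have [s sP] := choice (label_neq1 (pt := pt)).
have := @in_level_near_all p p_prime K iota K_alg _ s.
by apply: filterS => m h x; exists (Level (h x)); apply: sP.
Qed.

Lemma minus_one_descendE m g i j : entries_in_level m g ->
  val (nval (minus_one (descend p_prime iota m g)) i j) = nval (minus_one g) i j.
Proof.
move=> gm; rewrite !mxE rmorphB /= insubdK //; congr (_ - _).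
by case: (i == j); rewrite ?rmorph1 ?rmorph0.
Qed.

Lemma descend_arc_regular m g : entries_in_level m g ->
  (minus_one (descend p_prime iota m g) \in arc_regular pt) =
  (minus_one g \in arc_regular pt).
Proof.
move=> gm; apply/arc_regularP/arc_regularP => h x k l xD xk lx ne.
  by rewrite -(minus_one_descendE _ _ gm) (h x) // rmorph0.
by apply: val_inj; rewrite (minus_one_descendE _ _ gm) (h x) // rmorph0.
Qed.

Lemma arc_char_descend m g : entries_in_level m g ->
  arc_char (level_label m) (minus_one (descend p_prime iota m g)) =
  arc_char (label (p := pt)) (minus_one g).
Proof.
move=> gm; apply: eq_bigr => x _ /=; congr (label x _).
exact: minus_one_descendE.
Qed.

Lemma xi_levelE m g : xi_level p_prime iota m pt g =
  orbit_average (arc_char (level_label m)) (one_plus (minus_one (descend p_prime iota m g))).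
Proof. by rewrite minus_oneK. Qed.

Let orbit_finite m : finite_set (dual_orbit (arc_char (level_label m))).
Proof. exact/dual_orbit_finite/level_finite. Qed.

(** On H the sequence is thus eventually constant: the restricted character is itself invariant
    there. *)
Lemma xi_level_regular m g : entries_in_level m g -> minus_one g \in arc_regular pt ->
  xi_level p_prime iota m pt g = arc_char (label (p := pt)) (minus_one g).
Proof.
move=> gm gR; rewrite xi_levelE orbit_average_fixed ?arc_char_descend // => u v.
by rewrite arc_char_sandwich ?descend_arc_regular ?arc_char_descend.
Qed.

Lemma xi_level_decay_near g N : minus_one g \notin arc_regular pt ->
  \forall m \near \oo, `|xi_level p_prime iota m pt g| ^+ 2 * N%:R <= 1.
Proof.
move=> gN; near=> m.
have gm : entries_in_level m g by near: m; apply: entries_in_level_near.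
have [s [us sN]] : exists s : seq (level p_prime iota m), uniq s /\ size s = N.
  by near: m; apply: level_size_near.
have tau1 : forall x, exists s, level_label m x s != 1.
  by near: m; apply: level_label_neq1_near.
rewrite xi_levelE -sN.
apply: (irregular_decay tau1 (orbit_average_pd (orbit_finite m))) => //.
- by rewrite (orbit_average_fixed (orbit_finite m)) ?dual0 // => u v;
    rewrite arc_char_sandwich ?arc_regular0 ?dual0.
- exact: orbit_average_sandwich.
- by move=> h hR; rewrite (orbit_average_fixed (orbit_finite m)) // => u v;
    rewrite arc_char_sandwich.
- by rewrite descend_arc_regular.
Unshelve. all: by end_near. Qed.

Lemma xi_level_cvg g :
  xi_level p_prime iota m pt g @[m --> \oo] --> xi_limit pt (minus_one g).
Proof.
apply/cvgrPdist_lt => eps eps0; rewrite /xi_limit; case: ifPn => gR.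
  have := entries_in_level_near g; apply: filterS => m gm.
  by rewrite xi_level_regular // subrr normr0.
(* Off H, the decay bound for this [N] forces the modulus below [eps]. *)
have [N epsN] := complex_archimedean eps0.
have := xi_level_decay_near N gR; apply: filterS => m le1.
rewrite sub0r normrN -(ltr_pXn2r (n := 2)) ?nnegrE ?normr_ge0 ?(ltW eps0) //.
have N0 : 0 < N%:R :> R[i].
  by rewrite ltr0n lt0n; apply: contraTneq epsN => ->; rewrite mulr0 ltr10.
by rewrite -(ltr_pM2r N0) (le_lt_trans le1).
Qed.

Lemma xiE : xi p_prime iota pt = xi_limit pt \o @minus_one K n.
Proof.
by apply/funext => g; rewrite /xi /=;
  apply: (cvg_lim _ (@xi_level_cvg g)); apply: norm_hausdorff.
Qed.

End Convergence.

(** * Values on superclasses *)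

Lemma arc_matrix_entry (F : fieldType) (n : nat) (pa : Phi n (0 : F)) (k l : 'I_n) :
  (nval (arc_matrix (label (p := pa))) k l != 0) = ((k, l) \in arcs pa).
Proof.
rewrite /= summxE; have [klD|klN] := boolP ((k, l) \in arcs pa).
  rewrite (bigD1 (exist _ (k, l) klD : Defs.arc pa)) //= big1 => [|x].
    by rewrite addr0 !mxE !eqxx mulr1; apply/eqP/label_neq.
  rewrite -val_eqE /= !mxE => ne; case: andP => [[/eqP ek /eqP el]|]; rewrite ?mulr0 //.
  by case/eqP: ne; rewrite ek el -surjective_pairing.
apply/negbTE; rewrite negbK big1 // => x _; rewrite !mxE.
case: andP => [[/eqP ek /eqP el]|]; rewrite ?mulr0 //.
by case/negP: klN; rewrite ek el -surjective_pairing; apply: valP.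
Qed.

Lemma in_regular (n : nat) (pi : set_partition n) (x : 'I_n * 'I_n) : (x.1 < x.2)%N ->
  (x \in regular pi) = ~~ [exists a in arcs pi,
     ((x.1 == a.1) && (a.2 < x.2)%N) || ((x.2 == a.2) && (x.1 < a.1)%N)].
Proof. by move=> lt; rewrite /regular finset.in_setD !finset.in_set lt andbT. Qed.

(** Both sides say that the quadrant of each arc [x] of [pi] contains no arc of [pa] other than [x]:
    one in the row or column of [x] makes [x] singular, and one strictly inside is counted by
    [nest]. *)
Lemma arc_matrix_regular (F : fieldType) (n : nat) (pi : set_partition n)
    (pa : Phi n (0 : F)) :
  (arc_matrix (label (p := pa)) \in arc_regular pi) =
  (arcs pi \subset regular pa) && (nest pi pa == 0)%N.
Proof.
apply/arc_regularP/andP => [h|[/fintype.subsetP sub]].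
  have {}h x (k l : 'I_n) : x \in arcs pi -> (x.1 <= k)%N -> (l <= x.2)%N ->
      (k, l) \in arcs pa -> (k, l) = x.
    move=> xD xk lx; rewrite -arc_matrix_entry => kl; apply/eqP.
    by apply: contraNT kl => ne; rewrite (h x).
  split.
    apply/fintype.subsetP => x xD; rewrite in_regular ?(arcs_lt xD) //.
    apply/negP => /exists_inP[[k l] klD /= /orP[]/andP[/eqP e lt]].
      have := h x k l xD _ (ltnW lt) klD; rewrite e => /(_ (leqnn _)) ex.
      by move: lt; rewrite -ex ltnn.
    have := h x k l xD (ltnW lt) _ klD; rewrite e => /(_ (leqnn _)) ex.
    by move: lt; rewrite -ex ltnn.
  rewrite /nest sum_nat_eq0; apply/forall_inP => x xD.
  rewrite cards_eq0; apply/eqP/setP => -[k l]; rewrite finset.in_set0 finset.in_set /=.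
  apply/negP => /andP[klD /and3P[xk _ lx]].
  by have e := h x k l xD (ltnW xk) (ltnW lx) klD; move: xk; rewrite -e ltnn.
rewrite /nest sum_nat_eq0 => /forall_inP nest0 x k l xD xk lx ne.
apply/eqP; rewrite -[_ == 0]negbK arc_matrix_entry; apply/negP => klD.
have := sub x xD; rewrite in_regular ?(arcs_lt xD) // => /exists_inP sing.
have kl := arcs_lt klD; move: xk; rewrite leq_eqVlt => /predU1P[xk|xk].
  apply: sing; exists (k, l) => //=; rewrite -val_eqE /= xk eqxx /=.
  move: lx; rewrite leq_eqVlt => /predU1P[lx|->] //.
  by case/eqP: ne; case: x xk lx {xD} => i j /= /val_inj-> /val_inj->.
move: lx; rewrite leq_eqVlt => /predU1P[lx|lx].
  by apply: sing; exists (k, l) => //=; rewrite -!val_eqE /= lx eqxx xk orbT.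
have := nest0 x xD; rewrite cards_eq0 => /eqP/setP/(_ (k, l)).
by rewrite finset.in_set0 finset.in_set klD /= xk lx kl.
Qed.

Theorem proposition4p3 (R : realType) (p : nat) (p_prime : prime p)
    (K : closedFieldType) (iota : {rmorphism 'F_p -> K})
    (K_alg : forall x : K, algebraicOver iota x) (n : nat) :
  (forall pt : Phi n (trivial_char R[i] K),
     (forall g : unip K n, cvg (xi_level p_prime iota m pt g @[m --> \oo])) /\
     indecomposable_supercharacter (xi p_prime iota pt)) /\
  (forall (pt : Phi n (trivial_char R[i] K)) (pa : Phi n (0 : K)) (g : unip K n),
     superclass (arc_matrix (label (p := pa))) g ->
     xi p_prime iota pt g =
       if (arcs pt \subset regular pa) && (nest pt pa == 0)%N
       then arc_char (label (p := pt)) (arc_matrix (label (p := pa)))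
       else 0).
Proof.
split=> [pt|pt pa _ [gamma _ <-]].
  split=> [g|]; first by apply/cvg_ex; eexists; exact: xi_level_cvg.
  by rewrite xiE //; apply: xi_limit_indecomposable; apply: closed_field_infinite.
rewrite xiE //= one_plusK xi_limit_sandwich /xi_limit.
by rewrite arc_matrix_regular.
Qed.
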